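(* Let $N=2^L$ with $L$ a positive integer, let $D_1,\ldots,D_N,R$ be positive integers, and let $\mathcal{W}_{\mathrm{TN}}\in\mathbb{R}^{D_1\times\cdots\times D_N}$ be any tensor generated by the locally connected tensor network of width $R$ (defined in the context). Let $\mathcal{A}\in\mathbb{R}^{D_1\times\cdots\times D_N}$ and $\epsilon\in[0,\|\mathcal{A}\|/4]$. If $\|\mathcal{W}_{\mathrm{TN}}-\mathcal{A}\|\le\epsilon$, then for every canonical partition $(\mathcal{K},\mathcal{K}^c)\in\mathcal{C}_N$: $$\mathrm{QE}(\mathcal{A};\mathcal{K})\le \ln(R)+\frac{2\epsilon}{\|\mathcal{A}\|}\ln(D_{\mathcal{K}})+2\sqrt{\frac{2\epsilon}{\|\mathcal{A}\|}}$$ (with the convention that $\epsilon/\|\mathcal{A}\|=0$ if $\mathcal{A}=0$, in which case $\epsilon=0$). In contrast, there exists $\mathcal{A}'\in\mathbb{R}^{D_1\times\cdots\times D_N}$ such that for all canonical partitions $(\mathcal{K},\mathcal{K}^c)\in\mathcal{C}_N$: $$\mathrm{QE}(\mathcal{A}';\mathcal{K})\ge\min\{|\mathcal{K}|,|\mathcal{K}^c|\}\cdot\ln\big(\min_{n\in[N]}D_n\big).$$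
   Context: $[N]=\{1,\ldots,N\}$; norms are Frobenius (Euclidean) norms. For a tensor $\mathcal{A}\in\mathbb{R}^{D_1\times\cdots\times D_N}$ and $\mathcal{K}\subseteq[N]$, $\mathcal{K}^c=[N]\setminus\mathcal{K}$, $[\![\mathcal{A};\mathcal{K}]\!]$ is the matrix arrangement of $\mathcal{A}$ with rows indexed by the axes in $\mathcal{K}$ and columns by the axes in $\mathcal{K}^c$, and $D_{\mathcal{K}}:=\min\{\prod_{n\in\mathcal{K}}D_n,\prod_{n\in\mathcal{K}^c}D_n\}$. The quantum entanglement is $\mathrm{QE}(\mathcal{A};\mathcal{K}):=-\sum_{d=1}^{D_{\mathcal{K}}}\rho_d\ln\rho_d$ where $\rho_d=\sigma_d^2/\sum_{d'}\sigma_{d'}^2$ and $\sigma_1\ge\cdots\ge\sigma_{D_{\mathcal{K}}}$ are the singular values of $[\![\mathcal{A};\mathcal{K}]\!]$; by convention $\mathrm{QE}(0;\mathcal{K})=0$. The canonical partitions $\mathcal{C}_N$ are the pairs $(\mathcal{K},\mathcal{K}^c)$ with $\mathcal{K}=\{2^{L-l}(n-1)+1,\ldots,2^{L-l}n\}$ for $l\in\{0,\ldots,L\}$, $n\in[2^l]$. The locally connected tensor network of width $R$ is a tensor network whose graph is a perfect binary tree with $N$ leaves, the open edge at the $n$-th leaf (left to right) having dimension $D_n$ and all inner edges having dimension $R$; the tensors it generates are exactly those of the form: choose vectors $\phi^{(0,n)}_r\in\mathbb{R}^{D_n}$ ($n\in[N]$, $r\in[R]$); for $l=1,\ldots,L-1$,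 $n\in[2^{L-l}]$, $r\in[R]$ set $\phi^{(l,n)}_r=\sum_{i,j\in[R]}a^{(l,n)}_{r,i,j}\,\phi^{(l-1,2n-1)}_i\otimes\phi^{(l-1,2n)}_j$ with arbitrary real coefficients; and $\mathcal{W}_{\mathrm{TN}}=\sum_{i,j\in[R]}a_{i,j}\,\phi^{(L-1,1)}_i\otimes\phi^{(L-1,2)}_j$. *)

(* Defs.v *)
From HB Require Import structures.
From mathcomp Require Import all_boot all_order all_algebra.
From mathcomp Require Import boolp classical_sets reals exp.
Set Implicit Arguments. Unset Strict Implicit. Unset Printing Implicit Defensive.
Import Order.TTheory GRing.Theory Num.Theory.
Local Open Scope ring_scope.

Section Defs.
Variable F : realType.

Definition is_svd (I J : finType) (M : I -> J -> F)
    (s : 'I_(minn #|I| #|J|) -> F) : Prop :=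
  (forall d, 0 <= s d) /\
  (forall d e : 'I_(minn #|I| #|J|), (d <= e)%N -> s e <= s d) /\
  exists (u : 'I_(minn #|I| #|J|) -> I -> F) (w : 'I_(minn #|I| #|J|) -> J -> F),
    (forall d e, \sum_(i : I) u d i * u e i = (d == e)%:R) /\
    (forall d e, \sum_(j : J) w d j * w e j = (d == e)%:R) /\
    (forall i j, M i j = \sum_(d < minn #|I| #|J|) s d * u d i * w d j).

(* The singular values sigma_1 >= ... >= sigma_{min(|I|,|J|)} of M
   (chosen from an SVD; they are uniquely determined). *)
Definition svals (I J : finType) (M : I -> J -> F) : 'I_(minn #|I| #|J|) -> F :=
  match pselect (exists s, is_svd M s) with
  | left h => projT1 (cid h)
  | right _ => fun _ => 0
  end.

Definition xlnx (x : F) : F := if x == 0 then 0 else x * ln x.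

(* Quantum entanglement of a matrix: entropy of the normalized squared
   singular values; rho_d = sigma_d^2 / sum sigma^2 (= 0 if M = 0). *)
Definition QE_mx (I J : finType) (M : I -> J -> F) : F :=
  let s := svals M in
  let tot := \sum_(d < minn #|I| #|J|) s d ^+ 2 in
  - \sum_(d < minn #|I| #|J|) xlnx (s d ^+ 2 / tot).

Variables (L : nat) (D : nat -> nat).
Local Notation N := (2 ^ L)%N.

Definition Idx := {dffun forall n : 'I_N, 'I_(D n)}.
Definition tensor := Idx -> F.

Definition tnorm (A : tensor) : F := Num.sqrt (\sum_(x : Idx) A x ^+ 2).

Definition RowIdx (K : {set 'I_N}) :=
  {dffun forall k : {k : 'I_N | k \in K}, 'I_(D (val k))}.
Definition ColIdx (K : {set 'I_N}) :=
  {dffun forall k : {k : 'I_N | k \notin K}, 'I_(D (val k))}.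

Definition glue (K : {set 'I_N}) (r : RowIdx K) (c : ColIdx K) : Idx :=
  [ffun k : 'I_N =>
     match boolP (k \in K) with
     | AltTrue h => r (exist _ k h)
     | AltFalse h => c (exist _ k h)
     end].

Definition matricize (A : tensor) (K : {set 'I_N}) : RowIdx K -> ColIdx K -> F :=
  fun r c => A (@glue K r c).

Definition QE (A : tensor) (K : {set 'I_N}) : F := QE_mx (@matricize A K).

Definition DK (K : {set 'I_N}) : nat :=
  minn (\prod_(k in K) D k) (\prod_(k in ~: K) D k).

(* canonical partitions: K = {2^(L-l) n, ..., 2^(L-l) (n+1) - 1}, 0 <= l <= L, n < 2^l
   (0-based version of {2^(L-l)(n-1)+1, ..., 2^(L-l) n}, n in [2^l]) *)
Definition canonical_partition (K : {set 'I_N}) : Prop :=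
  exists l n, (l <= L)%N /\ (n < 2 ^ l)%N /\
    K = [set k : 'I_N | (n * 2 ^ (L - l) <= k < n.+1 * 2 ^ (L - l))%N].

(* A tensor on a block of modes is represented as a tensor on all modes that
   depends only on the block's coordinates; the tensor product of tensors on
   the two disjoint adjacent child blocks is then the pointwise product. *)
Variable R : nat.

(* phi l n r : node n (0-based) at level l, covering modes n 2^l .. (n+1) 2^l - 1.
   v n r : the leaf vectors phi^(0,n)_r in R^{D_n};
   a l n r i j : the coefficients a^(l,n)_{r,i,j}. *)
Fixpoint lc_phi (v : forall n : 'I_N, 'I_R -> 'I_(D n) -> F)
    (a : nat -> nat -> 'I_R -> 'I_R -> 'I_R -> F)
    (l n : nat) (r : 'I_R) (x : Idx) : F :=
  match l with
  | 0 => if (insub n : option 'I_N) is Some k then v k r (x k) else 0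
  | l'.+1 => \sum_(i < R) \sum_(j < R)
               a l n r i j * lc_phi v a l' (2 * n) i x * lc_phi v a l' (2 * n).+1 j x
  end.

Definition lc_tn (v : forall n : 'I_N, 'I_R -> 'I_(D n) -> F)
    (a : nat -> nat -> 'I_R -> 'I_R -> 'I_R -> F) (atop : 'I_R -> 'I_R -> F) : tensor :=
  fun x => \sum_(i < R) \sum_(j < R)
             atop i j * lc_phi v a L.-1 0 i x * lc_phi v a L.-1 1 j x.

Definition is_lc_tn (W : tensor) : Prop :=
  exists v a atop, forall x, W x = lc_tn v a atop x.

End Defs.

(* Main.v *)
Require Import Defs.
From HB Require Import structures.
From mathcomp Require Import all_boot all_order all_algebra.
From mathcomp Require Import boolp classical_sets reals exp.
From mathcomp Require Import zify ring lra.
Set Implicit Arguments. Unset Strict Implicit. Unset Printing Implicit Defensive.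
Import Order.TTheory GRing.Theory Num.Theory.
Local Open Scope ring_scope.

(* Cutting the tree along the edge above the block K writes W as a sum of R
   products of a function of the K-indices and a function of the K^c-indices, so
   its matricization has rank at most R.  By Eckart-Young the squared singular
   values of A beyond the R-th then add up to at most eps^2, i.e. the normalized
   spectrum has tail mass p <= (eps / |A|)^2.  Splitting the entropy at R gives
   QE <= ln R + p ln D_K + H(p), where the binary entropy H(p) is at most 2 sqrt p.
   For the converse, A' is a product of maximally entangled pairs of modes
   (k, k + N/2), restricted to the first min_n D_n coordinates: a canonical block
   other than [N] lies in one half of the modes and so cuts |K| of the pairs. *)

Lemma unlift_widen k (r : 'I_k) (le : (k <= k.+1)%N) : unlift ord_max (widen_ord le r) = Some r.
Proof.
rewrite (_ : widen_ord le r = lift ord_max r) ?liftK //.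
by apply: val_inj; rewrite /= /bump leqNgt ltn_ord.
Qed.

(** * Orthogonal projection, Bessel's inequality and Gram-Schmidt *)

Section Orthosys.
Variables (F : rcfType) (I : finType).
Implicit Types (f g h : I -> F) (e : nat -> I -> F) (z : pred nat).

Definition dotp f g : F := \sum_i f i * g i.

Lemma dotpC f g : dotp f g = dotp g f.
Proof. by apply: eq_bigr => i _; rewrite mulrC. Qed.

Lemma dotp_suml n (c : 'I_n -> F) (g : 'I_n -> I -> F) f :
  dotp (fun i => \sum_(r < n) c r * g r i) f = \sum_(r < n) c r * dotp (g r) f.
Proof.
rewrite /dotp; under eq_bigr do rewrite mulr_suml.
rewrite exchange_big /=; apply: eq_bigr => r _.
by rewrite mulr_sumr; apply: eq_bigr => i _; rewrite mulrA.
Qed.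

Lemma dotpBl f g h : dotp (fun i => f i - g i) h = dotp f h - dotp g h.
Proof. by rewrite /dotp -sumrB; apply: eq_bigr => i _; rewrite mulrBl. Qed.

Lemma dotpBB f g :
  dotp (fun i => f i - g i) (fun i => f i - g i) = dotp f f - dotp f g - (dotp g f - dotp g g).
Proof. by rewrite dotpBl ![dotp _ (fun i => f i - g i)]dotpC !dotpBl (dotpC g f). Qed.

Lemma dotp_ge0 f : 0 <= dotp f f.
Proof. by apply: sumr_ge0 => i _; rewrite -expr2 sqr_ge0. Qed.

Lemma dotp_eq0 f i : dotp f f = 0 -> f i = 0.
Proof.
move=> /eqP; rewrite psumr_eq0 => [/allP /(_ i (mem_index_enum _))|j _].
  by rewrite /= mulf_eq0 orbb => /eqP.
by rewrite -expr2 sqr_ge0.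
Qed.

Lemma dotp_basis f i : dotp f (fun k => (k == i)%:R) = f i.
Proof.
rewrite /dotp (bigD1 i) //= eqxx mulr1 big1 ?addr0 // => k /negPf ->.
by rewrite mulr0.
Qed.

(* Zero vectors are allowed, so that Gram-Schmidt never has to drop a vector:
   z tells which of the e_a are unit vectors. *)
Definition orthosys z k e : Prop :=
  forall a b, (a < k)%N -> (b < k)%N -> dotp (e a) (e b) = ((a == b) && z a)%:R.

Definition resid k e f : I -> F :=
  fun i => f i - \sum_(r < k) dotp f (e r) * e r i.

Section Projection.
Variables (z : pred nat) (k : nat) (e : nat -> I -> F).
Hypothesis eP : orthosys z k e.

(** If [z a] is false, [e a] has norm 0 and so is the zero vector; its coefficients vanish, and the
    projection formulas of an orthonormal family stay valid. *)
Lemma dotp_orthosys f (a : 'I_k) : dotp f (e a) * (z a)%:R = dotp f (e a).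
Proof.
case za: (z a); first by rewrite mulr1.
have e0 i : e a i = 0 by apply: dotp_eq0; rewrite eP // za andbF.
by rewrite /dotp big1 ?mul0r // => i _; rewrite e0 mulr0.
Qed.

Lemma resid_orth f (b : 'I_k) : dotp (resid k e f) (e b) = 0.
Proof.
rewrite dotpBl dotp_suml (bigD1 b) //= eP // eqxx /= dotp_orthosys big1 ?addr0 ?subrr //.
by move=> r /negPf rb; rewrite eP // (_ : (r == b :> nat) = false) ?mulr0.
Qed.

Lemma dotp_resid f g (c : 'I_k -> F) :
  dotp (resid k e f) (fun i => g i - \sum_(r < k) c r * e r i) = dotp (resid k e f) g.
Proof.
rewrite dotpC dotpBl dotp_suml big1 ?subr0 1?dotpC // => r _.
by rewrite dotpC resid_orth mulr0.
Qed.

Lemma resid_norm f :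
  dotp (resid k e f) (resid k e f) = dotp f f - \sum_(r < k) dotp f (e r) ^+ 2.
Proof.
rewrite dotp_resid dotpBl dotp_suml; congr (_ - _).
by apply: eq_bigr => r _; rewrite [dotp (e r) _]dotpC expr2.
Qed.

Lemma bessel f : \sum_(r < k) dotp f (e r) ^+ 2 <= dotp f f.
Proof. by rewrite -subr_ge0 -resid_norm dotp_ge0. Qed.

(** The residual [h] is orthogonal to [g - h], a combination of the [e r], so |g|^2 = |h|^2 + |g -
    h|^2: projection is the best approximation. *)
Lemma resid_le f (c : 'I_k -> F) (g := fun i => f i - \sum_(r < k) c r * e r i) :
  dotp f f - \sum_(r < k) dotp f (e r) ^+ 2 <= dotp g g.
Proof.
rewrite -resid_norm -subr_ge0; set h := resid k e f.
have hg : dotp h g = dotp h h.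
  by rewrite [RHS]dotp_resid dotp_resid.
have := dotp_ge0 (fun i => g i - h i).
by rewrite dotpBB [dotp g h]dotpC hg subrr subr0.
Qed.

(** A zero residual yields a zero vector here, which [gs_stepP] records with a false flag. *)
Definition gs_step f : nat -> I -> F :=
  fun a => if a == k then fun i => resid k e f i / Num.sqrt (dotp (resid k e f) (resid k e f))
           else e a.

Lemma gs_step_old f a : (a < k)%N -> gs_step f a = e a.
Proof. by rewrite /gs_step; case: eqP => // ->; rewrite ltnn. Qed.

Lemma gs_stepP f :
  orthosys (fun a => if a == k then dotp (resid k e f) (resid k e f) != 0 else z a)
    k.+1 (gs_step f).
Proof.
set h := resid k e f; set nh := dotp h h.
have hk (b : 'I_k) : dotp (gs_step f k) (e b) = 0.
  rewrite /gs_step eqxx -/h /dotp; under eq_bigr do rewrite mulrAC.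
  by rewrite -mulr_suml [X in X / _](resid_orth f b) mul0r.
move=> a b; rewrite !ltnS leq_eqVlt => /predU1P[->|ak]; rewrite leq_eqVlt => /predU1P[->|bk].
- rewrite eqxx /= /gs_step eqxx -/h -/nh /dotp.
  under eq_bigr do rewrite mulrACA.
  rewrite -mulr_suml -[X in X * _ = _]/nh -invfM -expr2 sqr_sqrtr ?dotp_ge0 //.
  by case: eqVneq => [->|nz]; rewrite ?mul0r ?divff.
- by rewrite (gs_step_old _ bk) (hk (Ordinal bk)) (gtn_eqF bk).
- by rewrite (gs_step_old _ ak) dotpC (hk (Ordinal ak)) (ltn_eqF ak).
- by rewrite (gs_step_old _ ak) (gs_step_old _ bk) eP // (ltn_eqF ak).
Qed.

End Projection.

Lemma gram_schmidt k (f : nat -> I -> F) :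
  exists z e, orthosys z k e /\
    forall a, (a < k)%N -> exists c : 'I_k -> F, forall i, f a i = \sum_(r < k) c r * e r i.
Proof.
elim: k => [|k [z [e [eP sp]]]]; first by exists xpredT, (fun=> fun=> 0); split=> // a b.
set h := resid k e (f k).
exists (fun a => if a == k then dotp h h != 0 else z a), (gs_step k e (f k)).
split=> [|a]; first exact: gs_stepP.
rewrite ltnS leq_eqVlt => /predU1P[->|/sp[c cP]].
  exists (fun r => if unlift ord_max r is Some r' then dotp (f k) (e r') else Num.sqrt (dotp h h)) => i.
  rewrite big_ord_recr /= unlift_none /gs_step eqxx -/h.
  under eq_bigr => r _.
    rewrite unlift_widen (ltn_eqF (ltn_ord r)); over.
  have -> : Num.sqrt (dotp h h) * (h i / Num.sqrt (dotp h h)) = h i.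
    have [h0|h0] := eqVneq (dotp h h) 0; first by rewrite h0 sqrtr0 mul0r (dotp_eq0 i h0).
    by rewrite mulrC divfK // sqrtr_eq0 -ltNge lt_neqAle eq_sym h0 dotp_ge0.
  by rewrite /h /resid addrC subrK.
exists (fun r => if unlift ord_max r is Some r' then c r' else 0) => i.
rewrite big_ord_recr /= unlift_none mul0r addr0 cP; apply: eq_bigr => r _.
by rewrite unlift_widen (gs_step_old _ _ (ltn_ord r)).
Qed.

(* For k < #|I| this forces a nonzero residual, i.e. a direction in which the
   orthonormal system can be extended. *)
Lemma sum_resid_basis k e : orthosys xpredT k e ->
  \sum_i dotp (resid k e (fun j => (j == i)%:R)) (resid k e (fun j => (j == i)%:R))
    = #|I|%:R - k%:R.
Proof.
move=> eP; under eq_bigr do rewrite (resid_norm eP) dotp_basis eqxx.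
rewrite sumrB sumr_const; congr (_ - _); rewrite exchange_big /=.
rewrite -[in RHS](card_ord k) -sumr_const; apply: eq_bigr => r _.
transitivity (dotp (e r) (e r)); last by rewrite eP // eqxx.
by apply: eq_bigr => i _; rewrite dotpC dotp_basis expr2.
Qed.

Lemma orthonormal_le k e : orthosys xpredT k e -> (k <= #|I|)%N.
Proof.
move=> /sum_resid_basis H; rewrite -(ler_nat F) -subr_ge0 -H.
by apply: sumr_ge0 => i _; apply: dotp_ge0.
Qed.

(** [is_svd] asks for full families of singular vectors, also for singular value 0; this completes a
    partial family. *)
Lemma orthonormal_extend k m e : (k <= m)%N -> (m <= #|I|)%N -> orthosys xpredT k e ->
  exists e', orthosys xpredT m e' /\ forall a, (a < k)%N -> e' a = e a.
Proof.
move=> /subnK <-; elim: (m - k)%N => [|n IH] lm eP; first by exists e.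
have [e1 [e1P e1e]] := IH (ltnW lm) eP.
have [i hi] : exists i, dotp (resid (n + k) e1 (fun j => (j == i)%:R))
                             (resid (n + k) e1 (fun j => (j == i)%:R)) != 0.
  (* If every standard basis vector had zero residual, the sum in [sum_resid_basis] would be 0
     instead of the positive #|I| - (n + k). *)
  apply: contrapT => none; suff: 0 < #|I|%:R - (n + k)%:R :> F.
    rewrite -(sum_resid_basis e1P) big1 ?ltxx // => i _.
    by apply/eqP; apply: contrapT => /negP ?; apply: none; exists i.
  by rewrite subr_gt0 ltr_nat.
exists (gs_step (n + k) e1 (fun j => (j == i)%:R)); split=> [a b ak bk|a ak].
  by rewrite (gs_stepP e1P) // hi; case: (a == (n + k)%N).
by rewrite gs_step_old ?e1e // ltn_addl.
Qed.

End Orthosys.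

(** * Estimates for - x ln x and for entropies *)

Section Entropy.
Variable F : realType.
Implicit Types (x q : F).

Lemma ln_le_sub1 x : 0 < x -> ln x <= x - 1.
Proof. by move=> x0; have := expR_ge1Dx (ln x); rewrite lnK ?posrE //; lra. Qed.

(** This is ln (q / x) <= q / x - 1 multiplied by [x]; summed over outcomes it becomes Gibbs'
    inequality with reference weights [q]. *)
Lemma gibbs_term x q : 0 <= x -> 0 < q -> - xlnx x <= q - x - x * ln q.
Proof.
move=> x0 q0; rewrite /xlnx; have [->|nz] := eqVneq x 0; first by rewrite mul0r; lra.
have xp : 0 < x by rewrite lt_neqAle eq_sym nz.
have := ln_le_sub1 (divr_gt0 q0 xp); rewrite ln_div ?posrE // -(ler_pM2l xp).
by rewrite !mulrBr mulrCA divff // mulr1; lra.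
Qed.

Lemma xlnx_le0 x : 0 <= x <= 1 -> xlnx x <= 0.
Proof.
move=> /andP[x0 x1]; rewrite /xlnx; case: eqP => // _.
by rewrite mulr_ge0_le0 // ln_le0.
Qed.

(* With y = sqrt x, - x ln x = - 2 y^2 ln y <= 2 y^2 (1/y - 1). *)
Lemma xlnx_sqrt x : 0 <= x -> - xlnx x <= 2 * Num.sqrt x - 2 * x.
Proof.
move=> x0; rewrite /xlnx; have [->|nz] := eqVneq x 0; first by rewrite sqrtr0; lra.
set y := Num.sqrt x; have yp : 0 < y by rewrite sqrtr_gt0 lt_neqAle eq_sym nz.
have -> : x = y ^+ 2 by rewrite sqr_sqrtr.
rewrite lnXn //.
have := gibbs_term (ltW yp) ltr01; rewrite /xlnx gt_eqF // ln1 mulr0 subr0 => H.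
have := ler_wpM2l (ltW yp) H; rewrite mulr2n; lra.
Qed.

(** Gibbs against the constant weight S / n: with at most [n] terms these weights add up to at most
    [S]. *)
Lemma entropy_group (T : finType) (P : pred T) (rho : T -> F) n
    (S := \sum_(d | P d) rho d) :
  (0 < n)%N -> (#|[pred d | P d]| <= n)%N -> (forall d, 0 <= rho d) ->
  - \sum_(d | P d) xlnx (rho d) <= S * ln n%:R - xlnx S.
Proof.
move=> n0 Pn rho0; have np : 0 < n%:R :> F by rewrite ltr0n.
have S0 : 0 <= S by apply: sumr_ge0.
have [SE|Snz] := eqVneq S 0.
  rewrite SE /xlnx eqxx mul0r subr0 oppr_le0 big1 // => d Pd.
  move/eqP: SE; rewrite psumr_eq0 // => /allP /(_ d (mem_index_enum _)) /implyP /(_ Pd) /eqP ->.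
  by rewrite eqxx.
have Sp : 0 < S by rewrite lt_neqAle eq_sym Snz.
have qp : 0 < S / n%:R by rewrite divr_gt0.
have le : - \sum_(d | P d) xlnx (rho d) <= \sum_(d | P d) (S / n%:R - rho d - rho d * ln (S / n%:R)).
  by rewrite -sumrN; apply: ler_sum => d _; apply: gibbs_term.
apply: le_trans le _; rewrite !big_split /= !sumrN -[X in _ - X]mulr_suml -/S sumr_const.
rewrite ln_div ?posrE // /xlnx (negPf Snz).
suff : S / n%:R *+ #|[pred d | P d]| <= S by lra.
by rewrite -mulr_natr mulrAC ler_pdivrMr // ler_pM2l // ler_nat.
Qed.

(** The head has at most [R] outcomes and mass 1 - p, the tail at most [m] and mass p;
    [entropy_group] on each gives (1 - p) ln R + p ln m + H(p). *)
Lemma entropy_tail m R (rho : 'I_m -> F) (p : F) :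
  (0 < R)%N -> (forall d, 0 <= rho d) -> \sum_d rho d = 1 ->
  p = \sum_(d < m | (R <= d)%N) rho d ->
  - \sum_d xlnx (rho d) <= ln R%:R + p * ln m%:R + 2 * Num.sqrt p.
Proof.
move=> R0 rho0 rho1 pE.
have m0 : (0 < m)%N.
  by case: m rho rho0 rho1 pE => // rho _; rewrite big_ord0 => /esym/eqP; rewrite oner_eq0.
have p0 : 0 <= p by rewrite pE sumr_ge0.
have headE : \sum_(d < m | ~~ (R <= d)%N) rho d = 1 - p.
  by rewrite -rho1 [X in _ = X - _](bigID (fun d : 'I_m => (R <= d)%N)) /= -pE addrAC subrr add0r.
have p1 : 0 <= 1 - p by rewrite -headE sumr_ge0.
have hc : (#|[pred d : 'I_m | ~~ (R <= d)%N]| <= R)%N.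
  rewrite -[X in (_ <= X)%N](card_ord R).
  rewrite -(card_in_imset (f := fun d : 'I_m => insubd (Ordinal R0) (val d))).
    exact: max_card.
  move=> d d'; rewrite !inE -!ltnNge => dR d'R /(congr1 val).
  by rewrite !val_insubd dR d'R => /val_inj.
have tc : (#|[pred d : 'I_m | (R <= d)%N]| <= m)%N.
  by rewrite -[X in (_ <= X)%N](card_ord m) max_card.
have := entropy_group R0 hc rho0; have := entropy_group m0 tc rho0; rewrite /= -pE headE.
rewrite [X in _ -> _ -> - X <= _](bigID (fun d : 'I_m => (R <= d)%N)) /=.
(* Here - p ln p <= 2 sqrt p - 2 p, and Gibbs with q = 1 gives - (1 - p) ln (1 - p) <= p; hence H(p)
   <= 2 sqrt p. *)
have := xlnx_sqrt p0; have := gibbs_term p1 ltr01; rewrite ln1 mulr0.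
have lnR : 0 <= ln R%:R :> F by rewrite ln_ge0 // ler1n.
have := mulr_ge0 p0 lnR; nra.
Qed.

(** Every outcome of nonzero weight has - ln rho >= ln n; average this with the weights rho. *)
Lemma entropy_flat (T : finType) (rho : T -> F) (n : nat) :
  (forall d, 0 <= rho d <= n%:R^-1) -> \sum_d rho d = 1 ->
  ln n%:R <= - \sum_d xlnx (rho d).
Proof.
move=> rhoP rho1; rewrite -sumrN -[ln _]mul1r -[X in X * _]rho1 mulr_suml.
apply: ler_sum => d _; have /andP[] := rhoP d; rewrite /xlnx.
case: eqVneq => [->|nz]; first by rewrite mul0r oppr0.
move=> rho0; have rp : 0 < rho d by rewrite lt_neqAle eq_sym nz.
move=> le; have np : 0 < n%:R :> F by rewrite -invr_gt0 (lt_le_trans rp).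
rewrite -mulrN ler_pM2l // -lnV ?posrE // ler_ln ?posrE ?invr_gt0 //.
by rewrite -[leLHS]invrK lef_pV2 ?posrE ?invr_gt0.
Qed.

End Entropy.

(** * Quadratic forms of an SVD and the Eckart-Young lower bound *)

Section SVD.
Variables (F : realType) (I J : finType) (M : I -> J -> F).
Local Notation m := (minn #|I| #|J|).

Definition ffnorm2 (B : I -> J -> F) : F := \sum_i \sum_j B i j ^+ 2.

Lemma ffnorm2_cols B : ffnorm2 B = \sum_j dotp (B^~ j) (B^~ j).
Proof.
by rewrite /ffnorm2 exchange_big; apply: eq_bigr => j _; apply: eq_bigr => i _; rewrite expr2.
Qed.

Section GivenSVD.
Variable s : 'I_m -> F.
Variables (u : 'I_m -> I -> F) (w : 'I_m -> J -> F).
Hypothesis uP : forall d e, dotp (u d) (u e) = (d == e)%:R.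
Hypothesis wP : forall d e, dotp (w d) (w e) = (d == e)%:R.
Hypothesis ME : forall i j, M i j = \sum_(d < m) s d * u d i * w d j.

(** Both sides are the quadratic form of M M^T at [e]; orthonormality of the [w d] makes it
    diagonal. *)
Lemma svd_quad (e : I -> F) :
  \sum_j dotp (M^~ j) e ^+ 2 = \sum_(d < m) s d ^+ 2 * dotp (u d) e ^+ 2.
Proof.
pose g d := s d * dotp (u d) e.
have E j : dotp (M^~ j) e = \sum_(d < m) g d * w d j.
  rewrite /dotp; under eq_bigr do rewrite ME mulr_suml.
  rewrite exchange_big /=; apply: eq_bigr => d _.
  by rewrite /g /dotp mulr_sumr mulr_suml; apply: eq_bigr => i _; ring.
under eq_bigr do rewrite E expr2.
rewrite -/(dotp (fun j => \sum_(d < m) g d * w d j) _) dotp_suml.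
apply: eq_bigr => d _; rewrite dotpC dotp_suml (bigD1 d) //= big1 => [|d' /negPf dd'].
  by rewrite wP eqxx mulr1 addr0 -expr2 exprMn.
by rewrite wP dd' mulr0.
Qed.

Lemma svd_norm2 : ffnorm2 M = \sum_(d < m) s d ^+ 2.
Proof.
transitivity (\sum_i \sum_(d < m) s d ^+ 2 * u d i ^+ 2).
  apply: eq_bigr => i _; have := svd_quad (fun k => (k == i)%:R).
  by under eq_bigr do rewrite dotp_basis; under [in RHS]eq_bigr do rewrite dotp_basis.
rewrite exchange_big /=; apply: eq_bigr => d _.
rewrite -mulr_sumr -[RHS]mulr1; congr (_ * _).
by transitivity (dotp (u d) (u d)); [apply: eq_bigr | rewrite uP eqxx].
Qed.

(** This lets a Gram matrix bound the singular values, whichever SVD they come from. *)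
Lemma svd_sqr d : s d ^+ 2 = \sum_j dotp (M^~ j) (u d) ^+ 2.
Proof.
rewrite svd_quad (bigD1 d) //= uP eqxx expr1n mulr1 big1 ?addr0 // => e /negPf ed.
by rewrite uP ed expr0n mulr0.
Qed.

Hypothesis s0 : forall d, 0 <= s d.
Hypothesis s_le : forall d e : 'I_m, (d <= e)%N -> s e <= s d.

(** A bathtub argument: weights in [0, 1] of total at most [R] collect the most from non-increasing
    values by filling the first [R] places. *)
Lemma weighted_head R (t : 'I_m -> F) :
  (forall d, 0 <= t d <= 1) -> \sum_d t d <= R%:R ->
  \sum_d s d ^+ 2 * t d <= \sum_(d < m | ~~ (R <= d)%N) s d ^+ 2.
Proof.
move=> t01 tR.
have [mR|Rm] := leqP m R.
  rewrite [leRHS](eq_bigl xpredT) => [|d]; last by rewrite -ltnNge (leq_trans (ltn_ord d)).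
  by apply: ler_sum => d _; have /andP[_] := t01 d; apply: ler_piMr; rewrite sqr_ge0.
(* With the threshold [a] taken at the 0-based index [R], (s_d^2 - a) (b_d - t_d) >= 0 for every d,
   while the sum of a (b_d - t_d) is nonnegative. *)
pose a := s (Ordinal Rm) ^+ 2; pose b (d : 'I_m) : F := (~~ (R <= d)%N)%:R.
have bR : \sum_d b d = R%:R.
  rewrite -natr_sum -big_mkcond /=; under eq_bigl do rewrite -ltnNge.
  by rewrite -(big_ord_widen _ (fun=> 1%N) (ltnW Rm)) sum1_card card_ord.
rewrite [leRHS]big_mkcond /= -subr_ge0 -sumrB.
apply: (@le_trans _ _ (\sum_d a * (b d - t d))).
  by rewrite -mulr_sumr sumrB bR mulr_ge0 ?sqr_ge0 // subr_ge0.
apply: ler_sum => d _; have /andP[t0 t1] := t01 d; rewrite /b.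
have [Rd|dR] /= := leqP R d.
  by rewrite !sub0r !mulrN lerN2 ler_wpM2r // ler_sqr ?nnegrE // s_le.
have -> : s d ^+ 2 - s d ^+ 2 * t d = s d ^+ 2 * (1 - t d) by rewrite mulrBr mulr1.
rewrite ler_wpM2r ?subr_ge0 // ler_sqr ?nnegrE //.
by rewrite s_le // ltnW.
Qed.

(** Projecting the columns of [M] on the span of the [f r] leaves an error no larger than that of
    [B]. The captured part is the sum of s_d^2 t_d, where t_d adds the squares of the products of
    u_d with the e_r. Bessel for [e] gives t_d <= 1, Bessel for [u] gives that the t_d add up to at
    most [R], and [weighted_head] applies. *)
Lemma svd_tail R (B : I -> J -> F) :
  (exists (f : nat -> I -> F) (g : nat -> J -> F),
     forall i j, B i j = \sum_(r < R) g r j * f r i) ->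
  \sum_(d < m | (R <= d)%N) s d ^+ 2 <= ffnorm2 (fun i j => M i j - B i j).
Proof.
move=> [f [g BE]]; have [z [e [eP sp]]] := gram_schmidt R f.
have [c cP] : exists c : nat -> 'I_R -> F,
    forall a, (a < R)%N -> forall i, f a i = \sum_(r < R) c a r * e r i.
  have : forall a, exists c : 'I_R -> F, (a < R)%N -> forall i, f a i = \sum_(r < R) c r * e r i.
    move=> a; have [/sp[c cP]|_] := ltnP a R; first by exists c.
    by exists (fun=> 0).
  by move=> /choice[c cP]; exists c.
pose k j r := \sum_(a < R) g a j * c a r.
have BE' i j : B i j = \sum_(r < R) k j r * e r i.
  rewrite BE; under eq_bigr => a _ do rewrite cP // mulr_sumr.
  rewrite exchange_big /=; apply: eq_bigr => r _.
  by rewrite /k mulr_suml; apply: eq_bigr => a _; rewrite mulrA.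
have proj : ffnorm2 M - \sum_(r < R) \sum_j dotp (M^~ j) (e r) ^+ 2
            <= ffnorm2 (fun i j => M i j - B i j).
  rewrite !ffnorm2_cols [X in _ - X]exchange_big /= -sumrB; apply: ler_sum => j _.
  apply: le_trans (resid_le eP (M^~ j) (k j)) _.
  rewrite le_eqVlt; apply/orP; left; apply/eqP.
  by apply: eq_bigr => i _; rewrite BE'.
apply: le_trans proj; rewrite svd_norm2 [X in _ <= X - _](bigID (fun d : 'I_m => (R <= d)%N)) /=.
rewrite -addrA lerDl subr_ge0.
under eq_bigr do rewrite svd_quad.
rewrite exchange_big /=; under eq_bigr do rewrite -mulr_sumr.
apply: weighted_head => [d|].
  rewrite sumr_ge0 => [/=|r _]; last exact: sqr_ge0.
  by have := bessel eP (u d); rewrite uP eqxx.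
have -> : R%:R = \sum_(r < R) 1 :> F by rewrite sumr_const card_ord.
rewrite exchange_big /=.
apply: ler_sum => r _.
(* [orthosys] is indexed by naturals, so [u] is padded with zeros. Bessel then bounds the
   contribution of [e r] by its squared norm, which is 0 or 1. *)
pose U a : I -> F := if insub a is Some d then u d else fun=> 0.
have UE (d : 'I_m) : U d = u d by rewrite /U valK.
have UP : orthosys xpredT m U.
  move=> a b am bm; rewrite -[a]/(val (Ordinal am)) -[b]/(val (Ordinal bm)) !UE uP andbT.
  by [].
have := bessel UP (e r); rewrite eP //= => H.
under eq_bigr do rewrite dotpC -UE.
by apply: le_trans H _; rewrite lern1; case: (_ && _).
Qed.

End GivenSVD.
End SVD.

(** * Entropy of matrices near low rank and of matrices with flat spectrum *)

Section EntanglementBounds.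
Variables (F : realType) (I J : finType).
Implicit Types (M B : I -> J -> F).
Local Notation m := (minn #|I| #|J|).

(* The second alternative is the junk value of svals; it is in fact never taken,
   but the bounds below hold for it as well. *)
Lemma svalsP M : is_svd M (svals M) \/ svals M = fun=> 0.
Proof. by rewrite /svals; case: pselect => [h|_]; [left; case: cid | right]. Qed.

Lemma svals_svd M : (exists s, is_svd M s) -> is_svd M (svals M).
Proof. by move=> h; rewrite /svals; case: pselect => [h'|//]; case: cid. Qed.

Lemma is_svd_norm2 M s : is_svd M s -> ffnorm2 M = \sum_d s d ^+ 2.
Proof. by move=> [_ [_ [u [w [uP [wP ME]]]]]]; exact: (svd_norm2 uP wP ME). Qed.

Lemma QE_mx_eq0 M : (forall d, svals M d = 0) -> QE_mx M = 0.
Proof.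
move=> s0; rewrite /QE_mx big1 ?oppr0 // => d _.
by rewrite s0 expr0n mul0r /xlnx eqxx.
Qed.

Lemma is_svd_eq0 M s : is_svd M s -> ffnorm2 M = 0 -> forall d, s d = 0.
Proof.
move=> /is_svd_norm2 -> /eqP; rewrite psumr_eq0 => [/allP h d|d _]; last exact: sqr_ge0.
by have := h d (mem_index_enum _); rewrite /= sqrf_eq0 => /eqP.
Qed.

Lemma rho_sum (s : 'I_m -> F) (tot := \sum_d s d ^+ 2) :
  0 < tot -> \sum_d s d ^+ 2 / tot = 1.
Proof. by move=> t0; rewrite -mulr_suml divff ?gt_eqF. Qed.

Lemma QE_mx_ge0 M : 0 <= QE_mx M.
Proof.
rewrite /QE_mx oppr_ge0; apply: sumr_le0 => d _; apply: xlnx_le0.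
have tot0 : 0 <= \sum_d svals M d ^+ 2 by apply: sumr_ge0 => e _; apply: sqr_ge0.
rewrite divr_ge0 ?sqr_ge0 //=; set t := \sum_ _ _ in tot0 *.
have [->|nz] := eqVneq t 0; first by rewrite invr0 mulr0.
rewrite ler_pdivrMr ?lt_neqAle 1?eq_sym ?nz // mul1r /t (bigD1 d) //= lerDl.
by apply: sumr_ge0 => e _; apply: sqr_ge0.
Qed.

Lemma QE_mx_near_low_rank M B R (a eps : F) :
  (0 < R)%N -> 0 <= a -> 0 <= eps -> eps <= a / 4 ->
  ffnorm2 M = a ^+ 2 -> ffnorm2 (fun i j => M i j - B i j) <= eps ^+ 2 ->
  (exists (f : nat -> I -> F) (g : nat -> J -> F),
     forall i j, B i j = \sum_(r < R) g r j * f r i) ->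
  QE_mx M <= ln R%:R + (2 * eps / a) * ln m%:R + 2 * Num.sqrt (2 * eps / a).
Proof.
move=> R0 a0 eps0 epsa Ma Meps low.
have lnR : 0 <= ln R%:R :> F by rewrite ln_ge0 // ler1n.
have lnm : 0 <= ln m%:R :> F.
  by case: (posnP m) => [->|m0]; [rewrite ln0 | rewrite ln_ge0 // ler1n].
have rhs0 : 0 <= 2 * eps / a by rewrite divr_ge0 // mulr_ge0.
have rhs : 0 <= ln R%:R + (2 * eps / a) * ln m%:R + 2 * Num.sqrt (2 * eps / a).
  by rewrite !addr_ge0 // mulr_ge0 ?sqrtr_ge0.
(* A vanishing spectrum, as junk value or because a = 0, has entropy 0, which is below the
   nonnegative right-hand side. *)
have [svd|s0] := svalsP M; last by rewrite QE_mx_eq0 // s0.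
have [az|anz] := eqVneq a 0.
  by rewrite QE_mx_eq0 //; apply: (is_svd_eq0 svd); rewrite Ma az expr0n.
have ap : 0 < a by rewrite lt_neqAle eq_sym anz.
have totE := is_svd_norm2 svd.
have [s0 [sle [u [w [uP [wP ME]]]]]] := svd.
rewrite /QE_mx -totE Ma.
set p := \sum_(d < m | (R <= d)%N) svals M d ^+ 2 / a ^+ 2.
(* Eckart-Young bounds the unnormalized tail by eps^2, and [epsa] turns this into 2 eps a. *)
have p_le : p <= 2 * eps / a.
  rewrite /p -mulr_suml ler_pdivrMr ?exprn_gt0 //.
  apply: le_trans (svd_tail uP wP ME s0 sle low) _; apply: le_trans Meps _.
  have -> : 2 * eps / a * a ^+ 2 = 2 * eps * a by field.
  by nra.
have p0 : 0 <= p by apply: sumr_ge0 => d _; rewrite divr_ge0 ?sqr_ge0.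
have rho0 d : 0 <= svals M d ^+ 2 / a ^+ 2 by rewrite divr_ge0 ?sqr_ge0.
have rho1 : \sum_d svals M d ^+ 2 / a ^+ 2 = 1.
  by rewrite -mulr_suml -totE Ma divff // expf_eq0.
have H := entropy_tail R0 rho0 rho1 (erefl p).
apply: le_trans H _; rewrite lerD // ?lerD // ?ler_wpM2r //.
by rewrite ler_wpM2l // ler_wsqrtr.
Qed.

Lemma sum_sqr_gram M (G : I -> I -> F) (v : I -> F) :
  (forall i i', \sum_j M i j * M i' j = G i i') ->
  \sum_j dotp (M^~ j) v ^+ 2 = \sum_i \sum_i' v i * v i' * G i i'.
Proof.
move=> GE; under [RHS]eq_bigr do under eq_bigr do rewrite -GE mulr_sumr.
under [RHS]eq_bigr do rewrite exchange_big /=.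
rewrite exchange_big /=; apply: eq_bigr => j _; rewrite expr2 mulr_suml.
apply: eq_bigr => i _; rewrite mulr_sumr; apply: eq_bigr => i' _; ring.
Qed.

Section FlatSpectrum.
Variables (M : I -> J -> F) (c : F) (S : {set I}).
Hypothesis c0 : 0 < c.
(** M M^T is [c] times a coordinate projection: the rows in [S] are orthogonal of norm sqrt c, the
    other rows vanish. *)
Hypothesis gram : forall i i', \sum_j M i j * M i' j = ((i == i') && (i \in S))%:R * c.

(** Left vectors are the basis vectors of [S], right vectors the rows divided by sqrt c; both
    families are completed with singular value 0. One explicit SVD ensures that [svals] does not
    take its junk value. *)
Lemma flat_svd : (0 < #|S|)%N -> exists s, is_svd M s.
Proof.
move=> /card_gt0P[i0 _].
pose f a := nth i0 (enum S) a.
have fS a : (a < #|S|)%N -> f a \in S.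
  by rewrite cardE => aS; rewrite -mem_enum mem_nth.
have f_inj a b : (a < #|S|)%N -> (b < #|S|)%N -> (f a == f b) = (a == b).
  by rewrite cardE => aS bS; rewrite nth_uniq ?enum_uniq.
have sc0 : 0 < Num.sqrt c by rewrite sqrtr_gt0.
pose u0 a : I -> F := fun i => (i == f a)%:R.
pose w0 a : J -> F := fun j => M (f a) j / Num.sqrt c.
have u0P : orthosys xpredT #|S| u0.
  by move=> a b aS bS; rewrite dotp_basis /u0 eq_sym f_inj // andbT.
have w0P : orthosys xpredT #|S| w0.
  move=> a b aS bS; rewrite /dotp /w0; under eq_bigr do rewrite mulrACA.
  rewrite -mulr_suml gram f_inj // fS // -invfM -expr2 sqr_sqrtr ?ltW //.
  by rewrite mulfK // gt_eqF.
have Sm : (#|S| <= m)%N by rewrite leq_min (orthonormal_le u0P) (orthonormal_le w0P).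
have [u [uP ue]] := orthonormal_extend Sm (geq_minl _ _) u0P.
have [w [wP we]] := orthonormal_extend Sm (geq_minr _ _) w0P.
exists (fun d => if (d < #|S|)%N then Num.sqrt c else 0); split; last split.
- by move=> d; case: ifP => // _; rewrite ltW.
- move=> d e de; case: ifP => [eS|_]; last by case: ifP => // _; rewrite ltW.
  by rewrite (leq_ltn_trans de eS).
exists u, w; split=> [d e|]; first by rewrite -/(dotp _ _) uP // andbT.
split=> [d e|i j]; first by rewrite -/(dotp _ _) wP // andbT.
transitivity (\sum_(i' in S) (i == i')%:R * M i' j).
  have [iS|iS] := boolP (i \in S).
    rewrite (bigD1 i) //= eqxx mul1r big1 ?addr0 // => i' /andP[_ /negPf].
    by rewrite eq_sym => ->; rewrite mul0r.
  rewrite big1 => [|i' i'S]; last first.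
    by case: eqP => [ii'|_]; [rewrite ii' i'S in iS | rewrite mul0r].
  by have := gram i i; rewrite eqxx (negPf iS) mul0r => /dotp_eq0 ->.
rewrite -big_enum /= (big_nth i0) big_mkord -cardE.
rewrite (big_ord_widen _ (fun d => (i == f d)%:R * M (f d) j) Sm) big_mkcond /=.
apply: eq_bigr => d _; case: ifP => [dS|_]; last by rewrite !mul0r.
by rewrite ue // we // /u0 /w0 [RHS]mulrC mulrA divfK ?gt_eqF // mulrC.
Qed.

(** The singular vectors behind [svals] may differ from those of [flat_svd]. Still s_d^2 is the form
    of M M^T at the unit vector u_d, so at most [c], and the total is |S| c; every weight is thus at
    most 1 / |S|. *)
Lemma QE_mx_flat : (0 < #|S|)%N -> ln #|S|%:R <= QE_mx M.
Proof.
move=> S0; have svd := svals_svd (flat_svd S0).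
have totE := is_svd_norm2 svd.
have normE : ffnorm2 M = #|S|%:R * c.
  rewrite /ffnorm2; transitivity (\sum_i (i \in S)%:R * c).
    by apply: eq_bigr => i _; rewrite -[LHS](eq_bigr _ (fun j _ => expr2 _)) gram eqxx.
  by rewrite -mulr_suml -natr_sum -big_mkcond /= sum1_card.
have tot0 : 0 < #|S|%:R * c by rewrite mulr_gt0 // ltr0n.
have [s0 [sle [u [w [uP [wP ME]]]]]] := svd.
rewrite /QE_mx -totE normE; apply: entropy_flat => [d|].
  rewrite divr_ge0 ?sqr_ge0 ?(ltW tot0) //= invfM mulrCA ger_pMr ?invr_gt0 ?ltr0n //.
  rewrite ler_pdivrMr // mul1r (svd_sqr uP wP ME) (sum_sqr_gram _ gram).
  apply: le_trans (_ : \sum_i c * (u d i * u d i) <= _).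
    apply: ler_sum => i _; rewrite (bigD1 i) //= big1 ?addr0 => [|i' /negPf ii'].
      rewrite eqxx mulrC; case: (i \in S); rewrite ?mul1r // !mul0r.
      by rewrite -expr2 mulr_ge0 ?sqr_ge0 // ltW.
    by rewrite eq_sym ii' mul0r mulr0.
  by rewrite -mulr_sumr [X in _ * X](uP d d) eqxx mulr1.
by rewrite -mulr_suml -totE normE divff // gt_eqF.
Qed.

End FlatSpectrum.
End EntanglementBounds.

(** * Row and column indices of a matricization *)

Section Matricization.
Variables (F : realType) (L : nat) (D : nat -> nat).
Local Notation N := (2 ^ L)%N.
Implicit Types (K : {set 'I_N}) (x y : Idx L D).

Definition row_part K x : RowIdx D K := [ffun k => x (val k)].
Definition col_part K x : ColIdx D K := [ffun k => x (val k)].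

Lemma glue_in K (r : RowIdx D K) c k (kK : k \in K) : glue r c k = r (exist _ k kK).
Proof.
rewrite /glue ffunE; case: {-}_ / boolP => h; last by case/negP: (h).
by rewrite (bool_irrelevance h kK).
Qed.

Lemma glue_notin K r (c : ColIdx D K) k (kK : k \notin K) : glue r c k = c (exist _ k kK).
Proof.
rewrite /glue ffunE; case: {-}_ / boolP => h; first by case/negP: (kK).
by rewrite (bool_irrelevance h kK).
Qed.

Lemma row_part_glue K (r : RowIdx D K) c : row_part K (glue r c) = r.
Proof. by apply/ffunP => -[k kK]; rewrite ffunE /= glue_in. Qed.

Lemma col_part_glue K r (c : ColIdx D K) : col_part K (glue r c) = c.
Proof. by apply/ffunP => -[k kK]; rewrite ffunE /= glue_notin. Qed.

Lemma glue_parts K x : glue (row_part K x) (col_part K x) = x.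
Proof.
apply/ffunP => k; have [kK|kK] := boolP (k \in K).
  by rewrite glue_in ffunE.
by rewrite glue_notin ffunE.
Qed.

Lemma glue_eq K (r : RowIdx D K) c x :
  (glue r c == x) = (r == row_part K x) && (c == col_part K x).
Proof.
apply/eqP/andP => [<-|[/eqP-> /eqP->]]; last exact: glue_parts.
by rewrite row_part_glue col_part_glue.
Qed.

Lemma tnorm_matricize (A : tensor F L D) K :
  ffnorm2 (matricize A (K := K)) = tnorm A ^+ 2.
Proof.
rewrite sqr_sqrtr; last by apply: sumr_ge0 => x _; apply: sqr_ge0.
rewrite /ffnorm2 pair_big /=.
rewrite [RHS](reindex (fun p : RowIdx D K * ColIdx D K => glue p.1 p.2)) //.
exists (fun x => (row_part K x, col_part K x)) => [[r c]|x] _ /=.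
  by rewrite row_part_glue col_part_glue.
exact: glue_parts.
Qed.

Lemma minn_card_DK K : minn #|RowIdx D K| #|ColIdx D K| = DK D K.
Proof.
rewrite /DK !card_dep_ffun !foldrE !big_image /=; congr minn.
  by rewrite (big_sub (mem K)) /=; apply: eq_bigr => k _; rewrite card_ord.
under [RHS]eq_bigl do rewrite finset.in_setC.
rewrite (big_sub (fun k => k \notin K)) /=; apply: eq_bigr => k _.
by rewrite card_ord.
Qed.

End Matricization.

(** * Cutting the tree network along one edge *)

Section LowRank.
Variables (F : realType) (L : nat) (D : nat -> nat) (R : nat).
Local Notation N := (2 ^ L)%N.
Variables (v : forall n : 'I_N, 'I_R -> 'I_(D n) -> F).
Variables (a : nat -> nat -> 'I_R -> 'I_R -> 'I_R -> F).
Implicit Types (x y : Idx L D).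

(** The blocks of the children 2n and 2n + 1 lie in that of the parent because k / 2^(l+1) = (k /
    2^l) / 2 in integer division. *)
Lemma lc_phi_local l n (r : 'I_R) x y :
  (forall k : 'I_N, (k %/ 2 ^ l)%N = n -> x k = y k) ->
  lc_phi v a l n r x = lc_phi v a l n r y.
Proof.
elim: l n r => [|l IH] n r xy /=.
  by case: insubP => // k _ kn; rewrite xy // divn1.
have child b (s : 'I_R) : (b < 2)%N -> lc_phi v a l (2 * n + b)%N s x = lc_phi v a l (2 * n + b)%N s y.
  move=> b2; apply: IH => k kb; apply: xy.
  by rewrite expnSr divnMA kb mulnC divnMDl // divn_small // addn0.
apply: eq_bigr => i _; apply: eq_bigr => j _.
by have := child 0 i isT; have := child 1 j isT; rewrite addn0 addn1 => -> ->.
Qed.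

Variables (l0 n0 : nat).
Let K : {set 'I_N} := [set k : 'I_N | k %/ 2 ^ l0 == n0]%N.

Definition off_block (g : Idx L D -> F) : Prop :=
  forall x y, (forall k, k \notin K -> x k = y k) -> g x = g y.

(** The block factors are fixed to be the [R] tensors at node (l0, n0); with these shared, sums of
    such functions still need only [R] terms. *)
Definition factors (f : Idx L D -> F) : Prop :=
  exists g : 'I_R -> Idx L D -> F, (forall q, off_block (g q)) /\
    forall x, f x = \sum_(q < R) lc_phi v a l0 n0 q x * g q x.

(** Coefficients and off-block multipliers are absorbed into the off-block factors, so no new terms
    arise. *)
Lemma factors_node (al : 'I_R -> 'I_R -> F) (p q : 'I_R -> Idx L D -> F) :
  (forall i, factors (p i)) -> (forall j, off_block (q j)) ->
  factors (fun x => \sum_(i < R) \sum_(j < R) al i j * p i x * q j x).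
Proof.
move=> /choice[g gP] qP.
exists (fun s x => \sum_(i < R) \sum_(j < R) al i j * g i s x * q j x); split.
  move=> s x y xy; apply: eq_bigr => i _; apply: eq_bigr => j _.
  by rewrite (qP j x y) // ((gP i).1 s x y).
move=> x; under [RHS]eq_bigr do rewrite mulr_sumr.
rewrite [RHS]exchange_big /=; apply: eq_bigr => i _.
under [RHS]eq_bigr do rewrite mulr_sumr.
rewrite [RHS]exchange_big /=; apply: eq_bigr => j _.
rewrite (gP i).2 mulr_sumr mulr_suml; apply: eq_bigr => s _; ring.
Qed.

(** At level l0 + t, only the ancestor n0 / 2^t has a block meeting [K]. *)
Lemma off_block_phi t m (r : 'I_R) : m != (n0 %/ 2 ^ t)%N ->
  off_block (lc_phi v a (l0 + t)%N m r).
Proof.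
move=> mn x y xy; apply: lc_phi_local => k km; apply: xy.
rewrite inE; apply: contra mn => /eqP <-.
by rewrite -km expnD divnMA.
Qed.

(** One child is the ancestor of the block, the other is off the block, and the parity of the
    ancestor decides which is which. The coefficients [al] are arbitrary so that the step serves
    inner nodes and the root alike. *)
Lemma factors_parent t m (al : 'I_R -> 'I_R -> F) : m = (n0 %/ 2 ^ t)./2%N ->
  (forall r, factors (lc_phi v a (l0 + t)%N (n0 %/ 2 ^ t)%N r)) ->
  factors (fun x => \sum_(i < R) \sum_(j < R)
     al i j * lc_phi v a (l0 + t)%N (2 * m)%N i x * lc_phi v a (l0 + t)%N (2 * m).+1%N j x).
Proof.
set c := (n0 %/ 2 ^ t)%N => mc cP; have cE := odd_double_half c.
rewrite -mc -mul2n in cE; case: (odd c) cE => /= cE; last first.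
  rewrite add0n in cE; apply: factors_node => [i|j]; first by rewrite cE.
  by apply: off_block_phi; rewrite -/c -cE gtn_eqF.
rewrite add1n in cE.
(* The ancestor is the right child here, so the two summation indices trade roles. *)
have [g [gP gE]] : factors (fun x => \sum_(j < R) \sum_(i < R)
     al i j * lc_phi v a (l0 + t)%N (2 * m).+1%N j x * lc_phi v a (l0 + t)%N (2 * m)%N i x).
  apply: (factors_node (fun j i => al i j)) => [j|i]; first by rewrite cE.
  by apply: off_block_phi; rewrite -/c -cE ltn_eqF.
exists g; split=> // x; rewrite -gE exchange_big /=.
by apply: eq_bigr => i _; apply: eq_bigr => j _; rewrite mulrAC.
Qed.

Lemma factors_ancestor t r : factors (lc_phi v a (l0 + t)%N (n0 %/ 2 ^ t)%N r).
Proof.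
elim: t r => [|t IH] r.
  rewrite addn0 expn0 divn1; exists (fun q _ => (q == r)%:R); split=> // x.
  rewrite (bigD1 r) //= eqxx mulr1 big1 ?addr0 // => q /negPf ->.
  by rewrite mulr0.
rewrite addnS /=; apply: factors_parent IH.
by rewrite expnSr divnMA divn2.
Qed.

Lemma lc_tn_factors atop : (l0 < L)%N -> (n0 < 2 ^ (L - l0))%N ->
  factors (lc_tn v a atop).
Proof.
move=> lL nL; have E : (l0 + (L.-1 - l0))%N = L.-1 by lia.
have := @factors_parent (L.-1 - l0) 0 atop _ (factors_ancestor _); rewrite E; apply.
(* The ancestor at level L - 1 has index 0 or 1, whose half is 0, so the root acts as its parent. *)
suff : (n0 %/ 2 ^ (L.-1 - l0) < 2)%N by case: (_ %/ _)%N => [|[|]].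
rewrite ltn_divLR ?expn_gt0 // -expnS.
by have -> : (L.-1 - l0).+1 = (L - l0)%N by lia.
Qed.

End LowRank.

(** * Canonical blocks and the rank bound for matricizations *)

Section CanonicalBlocks.
Variables (F : realType) (L : nat) (D : nat -> nat).
Local Notation N := (2 ^ L)%N.
Hypothesis D_gt0 : forall n, (n < N)%N -> (0 < D n)%N.
Implicit Types (K : {set 'I_N}).

(** A filler: gluing with a part of [x0] turns a function of all indices into one of the row or
    column index alone. *)
Let x0 : Idx L D := [ffun k : 'I_N => Ordinal (D_gt0 (ltn_ord k))].

(** Levels are recounted from the leaves, as in [lc_phi], and a dyadic interval is a fibre of
    division by 2^l0. *)
Lemma canonical_block K : canonical_partition K ->
  exists l0 n0, [/\ (l0 <= L)%N, (n0 < 2 ^ (L - l0))%N &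
                    K = [set k : 'I_N | k %/ 2 ^ l0 == n0]%N].
Proof.
move=> [l [n [lL [nl ->]]]]; exists (L - l)%N, n; split; rewrite ?leq_subr ?subKn //.
apply/setP => k; rewrite !inE eqn_leq -(ltnS _ n).
by rewrite ltn_divLR ?expn_gt0 // leq_divRL ?expn_gt0 // andbC.
Qed.

Lemma lc_tn_low_rank R (W : tensor F L D) K :
  (0 < R)%N -> is_lc_tn R W -> canonical_partition K ->
  exists (f : nat -> RowIdx D K -> F) (g : nat -> ColIdx D K -> F),
    forall r c, matricize W r c = \sum_(q < R) g q c * f q r.
Proof.
move=> R0 [v [a [atop WE]]] /canonical_block[l0 [n0 [lL nL KE]]].
pose r0 := row_part K x0; pose c0 := col_part K x0.
(* For l0 = L the block contains all modes and there is a single column, so the term of index 0,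
   present by [R0], suffices. *)
move: lL; rewrite leq_eqVlt => /predU1P[l0L|lL].
  have KT k : k \in K.
    move: nL; rewrite KE inE l0L subnn ltnS leqn0 => /eqP ->.
    by rewrite divn_small.
  exists (fun q r => if q == 0%N then W (glue r c0) else 0), (fun _ _ => 1) => r c.
  rewrite (bigD1 (Ordinal R0)) //= mul1r big1 ?addr0 => [|q q0].
    by congr (W (glue r _)); apply/ffunP => -[k kK]; case/negP: (kK).
  by rewrite mul1r ifN.
have [g [gP gE]] := lc_tn_factors v a atop lL nL.
exists (fun q r => if insub q is Some q' then lc_phi v a l0 n0 q' (glue r c0) else 0).
exists (fun q c => if insub q is Some q' then g q' (glue r0 c) else 0) => r c.
rewrite /matricize WE gE; apply: eq_bigr => q _; rewrite valK mulrC; congr (_ * _).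
  by apply: gP => k; rewrite -KE => kK; rewrite !glue_notin.
apply: lc_phi_local => k kn; have kK : k \in K by rewrite KE inE kn.
by rewrite !glue_in.
Qed.

End CanonicalBlocks.

(** * Gram matrix of the incidence matrix of two maps *)

Section GraphMatrix.
Variables (F : realType) (Y I J : finType) (rho : Y -> I) (kap : Y -> J).
Hypothesis kap_inj : injective kap.
Variable c : nat.
Hypothesis fiber : forall y0, #|[pred y | rho y == rho y0]| = c.

Definition graph_mx : I -> J -> F :=
  fun i j => \sum_y ((i == rho y) && (j == kap y))%:R.

(** As [kap] is injective, a column sees at most one [y]. Hence distinct rows have disjoint
    supports, and a row in the image of [rho] has exactly [c] entries, all equal to 1. *)
Lemma graph_mx_gram i i' :
  \sum_j graph_mx i j * graph_mx i' j = ((i == i') && (i \in rho @: Y))%:R * c%:R.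
Proof.
transitivity (\sum_y ((i == rho y) && (i' == rho y))%:R : F).
  under eq_bigr do rewrite mulr_suml.
  rewrite exchange_big /=; apply: eq_bigr => y _.
  rewrite (bigD1 (kap y)) //= eqxx andbT big1 ?addr0 => [|j /negPf ->]; last by rewrite andbF mul0r.
  rewrite /graph_mx (bigD1 y) //= eqxx andbT big1 ?addr0 => [|y' /negPf yy'].
    by case: (_ == _); rewrite ?mul1r ?mul0r.
  by rewrite (inj_eq kap_inj) [y == y']eq_sym yy' andbF.
have [<-|ii'] /= := eqVneq i i'; last first.
  rewrite mul0r big1 // => y _; case: (i =P rho y) => //= iE; case: eqP => // i'E.
  by rewrite iE i'E eqxx in ii'.
under eq_bigr do rewrite andbb.
rewrite -natr_sum -big_mkcond /= sum1_card.
have [/imsetP[y0 _ ->]|iY] := boolP (i \in rho @: Y).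
  by rewrite mul1r -(fiber y0); congr (_%:R); apply: eq_card => y; rewrite !inE eq_sym.
rewrite mul0r eq_card0 // => y; rewrite inE.
by apply: contraNF iY => /eqP ->; apply: imset_f.
Qed.

Lemma graph_mx_card : (#|rho @: Y| * c)%N = #|Y|.
Proof.
rewrite -[RHS]sum1_card (partition_big_imset rho) /= -sum_nat_const; apply/esym.
apply: eq_bigr => i /imsetP[y0 _ ->]; rewrite sum1_card -(fiber y0).
by apply: eq_card => y; rewrite !inE.
Qed.

End GraphMatrix.

(** * The tensor of maximally entangled pairs of modes *)

Section EntangledPairs.
Variables (L : nat).
Local Notation N := (2 ^ L)%N.
Local Notation h := (2 ^ L.-1)%N.
Hypothesis L_gt0 : (0 < L)%N.

Let h_gt0 : (0 < h)%N. Proof. by rewrite expn_gt0. Qed.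

Let N_eq : N = (2 * h)%N. Proof. by rewrite -expnS prednK. Qed.

(** The value names the pair: modes k and k + h share it. *)
Definition half_mode (k : 'I_N) : 'I_h := Ordinal (ltn_pmod k h_gt0).

(** For l0 < L, h is a multiple of 2^l0, so the modes of the block share their quotient by h; the
    residue then determines the mode. *)
Lemma canonical_half_inj (K : {set 'I_N}) : canonical_partition K -> K != [set: 'I_N]%SET ->
  {in K &, injective half_mode}.
Proof.
move=> /canonical_block[l0 [n0 [lL nL ->]]] KT k k'.
move: lL; rewrite leq_eqVlt => /predU1P[E|lL].
  case/eqP: KT; apply/setP => j; move: nL; rewrite !inE E subnn ltnS leqn0 => /eqP ->.
  by rewrite divn_small.
rewrite !inE => /eqP kn /eqP k'n /(congr1 val) /= kk'.
apply: val_inj; rewrite /= (divn_eq k h) (divn_eq k' h) kk'; congr (_ * _ + _)%N.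
have -> : h = (2 ^ l0 * 2 ^ (L.-1 - l0))%N by rewrite -expnD; congr (2 ^ _)%N; lia.
by rewrite !divnMA kn k'n.
Qed.

Variables (F : realType) (D : nat -> nat) (d : nat).
Hypothesis d_gt0 : (0 < d)%N.
Hypothesis d_le : forall k : 'I_N, (d <= D k)%N.

Let Y := {ffun 'I_h -> 'I_d}.

Definition pair_idx (y : Y) : Idx L D := [ffun k => widen_ord (d_le k) (y (half_mode k))].

(** Up to a scalar this is a product of maximally entangled states, one per pair; [QE] normalizes
    the spectrum, so the scalar is irrelevant. *)
Definition pairs_tensor : tensor F L D := fun x => \sum_(y : Y) (x == pair_idx y)%:R.

Lemma matricize_pairs K r c :
  matricize pairs_tensor r c =
  graph_mx F (fun y => row_part K (pair_idx y)) (fun y => col_part K (pair_idx y)) r c.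
Proof. by apply: eq_bigr => y _; rewrite glue_eq. Qed.

(** [K] meets each pair at most once, so the column index determines all of [y], while the row index
    shows [y] on exactly |K| pairs. The matricization is thus a graph matrix with d^|K| nonzero rows
    and flat spectrum. *)
Lemma QE_pairs_tensor (K : {set 'I_N}) : {in K &, injective half_mode} ->
  ln (d ^ #|K|)%:R <= QE pairs_tensor K.
Proof.
move=> half_inj.
have col_inj : injective (fun y => col_part K (pair_idx y)).
  move=> y y' /ffunP E; apply/ffunP => t.
  (* Of the two modes t and t + h of a pair, at least one lies outside [K]. *)
  suff [k kK kt] : exists2 k, k \notin K & half_mode k = t.
    have /(congr1 val) /= := E (exist _ k kK).
    by rewrite !ffunE /= kt => /val_inj.
  have k1P : (t < N)%N by rewrite N_eq mul2n -addnn ltn_addr.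
  have k2P : (t + h < N)%N by rewrite N_eq mul2n -addnn ltn_add2r.
  have k1t : half_mode (Ordinal k1P) = t by apply: val_inj; rewrite /= modn_small.
  have k2t : half_mode (Ordinal k2P) = t by apply: val_inj; rewrite /= modnDr modn_small.
  have [k1K|k1K] := boolP (Ordinal k1P \in K); last by exists (Ordinal k1P).
  exists (Ordinal k2P) => //; apply/negP => k2K.
  have /(congr1 val) /= /eqP := half_inj _ _ k1K k2K (etrans k1t (esym k2t)).
  by rewrite -[X in X == _]addn0 eqn_add2l eq_sym gtn_eqF.
have cK : (#|K| <= h)%N by rewrite -(card_in_imset half_inj) -[X in (_ <= X)%N](card_ord h) max_card.
have fiber y0 : #|[pred y | row_part K (pair_idx y) == row_part K (pair_idx y0)]| = (d ^ (h - #|K|))%N.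
  (* A row index fixes [y] on the pairs met by [K] and leaves [d] choices on each of the other h -
     |K| pairs. *)
  pose P t : pred 'I_d := if t \in half_mode @: K then pred1 (y0 t) else predT.
  transitivity #|family P|.
    apply: eq_card => y; rewrite !inE; apply/eqP/familyP => [/ffunP E t|yP].
      rewrite /P; case: imsetP => // -[k kK ->].
      have /(congr1 val) /= := E (exist _ k kK).
      by rewrite !ffunE /= => /val_inj ->; rewrite inE.
    apply/ffunP => -[k kK]; rewrite !ffunE /=; apply: val_inj => /=.
    by have := yP (half_mode k); rewrite /P imset_f // inE => /eqP ->.
  rewrite card_family foldrE big_image /= (bigID (mem (half_mode @: K))) /=.
  rewrite big1 => [|t tK]; last by rewrite /P tK card1.
  rewrite mul1n (eq_bigr (fun=> d)) => [|t /negPf tK]; last by rewrite /P tK card_ord.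
  rewrite prod_nat_const; congr (d ^ _)%N.
  have := cardsC (half_mode @: K); rewrite card_ord (card_in_imset half_inj) => /(canRL (addKn _)) <-.
  by apply: eq_card => t; rewrite !inE.
have gram := graph_mx_gram F col_inj fiber.
have card := graph_mx_card fiber.
set S := _ @: _ in gram card.
have SE : #|S| = (d ^ #|K|)%N.
  apply/eqP; rewrite -(@eqn_pmul2r (d ^ (h - #|K|))) ?expn_gt0 ?d_gt0 //.
  by rewrite card card_ffun !card_ord -expnD subnKC.
have c0 : 0 < (d ^ (h - #|K|))%:R :> F by rewrite ltr0n expn_gt0 d_gt0.
rewrite -SE; apply: (QE_mx_flat c0) => [r r'|]; last by rewrite SE expn_gt0 d_gt0.
by rewrite -gram; apply: eq_bigr => c _; rewrite !matricize_pairs.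
Qed.

End EntangledPairs.

(** * Assembly of the upper bound and of the highly entangled tensor *)

Lemma bigminn_le n x (f : 'I_n -> nat) k : (\big[minn/x]_(i < n) f i <= f k)%N.
Proof. exact: (@Order.TotalTheory.bigmin_le_cond _ nat _ x k xpredT f). Qed.

Theorem theorem1 (F : realType) (L : nat) (D : nat -> nat) (R : nat) :
  (0 < L)%N -> (forall n, (n < 2 ^ L)%N -> (0 < D n)%N) -> (0 < R)%N ->
  (forall (W A : tensor F L D) (eps : F),
     is_lc_tn R W ->
     0 <= eps -> eps <= tnorm A / 4 ->
     tnorm (fun x => W x - A x) <= eps ->
     forall K : {set 'I_(2 ^ L)}, canonical_partition K ->
       QE A K <= ln (R%:R : F) + (2 * eps / tnorm A) * ln ((DK D K)%:R : F)
                 + 2 * Num.sqrt (2 * eps / tnorm A))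
  /\
  (exists A' : tensor F L D,
     forall K : {set 'I_(2 ^ L)}, canonical_partition K ->
       (minn #|K| #|~: K|)%:R * ln ((\big[minn/D 0%N]_(n < 2 ^ L) D n)%:R : F)
         <= QE A' K).
Proof.
move=> L0 D0 R0; split=> [W A eps Wtn eps0 epsA WA K Kcan|].
  rewrite -minn_card_DK; apply: (QE_mx_near_low_rank (B := matricize W (K := K))) => //.
  - exact: sqrtr_ge0.
  - exact: tnorm_matricize.
  - apply: le_trans (_ : tnorm (fun x => W x - A x) ^+ 2 <= _).
      rewrite -(tnorm_matricize _ K) le_eqVlt; apply/orP; left; apply/eqP.
      by apply: eq_bigr => r _; apply: eq_bigr => c _; rewrite -sqrrN opprB.
    by rewrite ler_sqr ?nnegrE ?sqrtr_ge0.
  - exact: lc_tn_low_rank.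
set d := \big[_/_]_(_ < _) _.
have d_le (k : 'I_(2 ^ L)) : (d <= D k)%N by exact: bigminn_le.
(* The default [D 0] of the minimum is one of the dimensions, hence also positive. *)
have d_gt0 : (0 < d)%N.
  by apply: (big_ind (fun n => 0 < n)%N) => [|x y|i _]; rewrite ?D0 ?leq_min ?expn_gt0 // => -> ->.
exists (pairs_tensor F d_le) => K Kcan.
(* The full set contains both modes of each pair, so [half_mode] is not injective on it; but its
   complement is empty and the bound to reach is 0. *)
have [->|KT] := eqVneq K [set: 'I_(2 ^ L)]%SET; first by rewrite finset.setCT cards0 minn0 mul0r QE_mx_ge0.
apply: le_trans (QE_pairs_tensor L0 F d_gt0 d_le (canonical_half_inj L0 Kcan KT)).
rewrite natrX lnXn ?ltr0n // -[leRHS]mulr_natl ler_wpM2r ?ler_nat ?geq_minl //.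
by rewrite ln_ge0 // ler1n.
Qed.
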